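(* Let $p$ be an odd prime and let $x$ be a variable. Then $$\sum_{k=0}^{p-1}\binom{2k}{k}\binom{3k}{k}\binom{6k}{3k}\bigl(x(1-432x)\bigr)^k\equiv \left(\sum_{k=0}^{p-1}\binom{3k}{k}\binom{6k}{3k}x^k\right)^2\pmod{p^2}.$$
   Context: The congruence is one of polynomials in $\mathbb{Z}[x]$ (coefficientwise congruence modulo $p^2$). *)

(* Defs.v *)
From mathcomp Require Import all_boot all_order all_algebra.

Set Implicit Arguments.
Unset Strict Implicit.
Unset Printing Implicit Defensive.

Import GRing.Theory.
Local Open Scope ring_scope.

Definition eqpoly_mod (m : int) (f g : {poly int}) : Prop :=
  forall i : nat, (f`_i = g`_i %[mod m])%Z.

(* Main.v *)
Require Import Defs.
From mathcomp Require Import all_boot all_order all_algebra.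
From mathcomp Require Import ring zify.

(** Write a_k = C(3k,k) C(6k,3k), b_k = C(2k,k) a_k and w = x(1 - 432x).
    Without truncation the two sides are equal: this is Clausen's formula
    sum b_k w^k = (sum a_k x^k)^2.  Indeed y = sum a_k x^k solves the
    hypergeometric equation (w y')' = 60 y, hence y^2 solves the third-order
    symmetric square of that equation, and the 3F2 equation of sum b_k u^k,
    pulled back along u = w, is that same symmetric square.

    Truncating at k < N perturbs the two hypergeometric equations only by the
    boundary terms - N^2 a_N x^(N-1) and - N^3 b_N u^(N-1).  So the symmetric
    square operator maps the defect
      E_N = sum_(k < N) b_k w^k - (sum_(k < N) a_k x^k)^2
    to a multiple of N^2 x^(N-1) ([symsq_defect]).  The operator acts on
    coefficients by e_(n+1) |-> (n+1)^3 e_(n+1) plus an integral combination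
    of e_0, ..., e_n ([symsq_coef_rec]), which yields the following for the
    coefficients e_n of E_N.
    - For n < N the recurrence is homogeneous and e_0 = 0, so e_n = 0
      ([coef_defect_lt]).
    - For n = N, the vanishing just obtained applies to E_(N+1); comparing
      E_(N+1) with E_N gives e_N = 2 a_N - b_N = (2 - C(2N,N)) a_N
      ([coef_defect_eq]).  For N = p prime this is divisible by p^2, because
      C(2p,p) = sum_k C(p,k)^2 is 2 modulo p^2.
    - For N = p < n < 2p the recurrence holds modulo p^2, and the factor n^3
      is prime to p, so p^2 still divides e_n ([defect_prime]).
    The degree of E_p is at most 2p - 2, so no coefficient is left. *)

Set Implicit Arguments.
Unset Strict Implicit.
Unset Printing Implicit Defensive.

Import GRing.Theory Num.Theory.
Local Open Scope ring_scope.

(** * The coefficients of Clausen's formula *)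

Definition clausen_a (k : nat) : nat := ('C(3 * k, k) * 'C(6 * k, 3 * k))%N.
Definition clausen_b (k : nat) : nat := ('C(2 * k, k) * clausen_a k)%N.

Lemma clausen_a_fact k :
  (clausen_a k * (k`! * (2 * k)`! * (3 * k)`!) = (6 * k)`!)%N.
Proof.
have h3 := @bin_fact (3 * k) k (leq_pmull k (isT : (0 < 3)%N)).
have h6 := @bin_fact (6 * k) (3 * k) (leq_mul (isT : (3 <= 6)%N) (leqnn k)).
rewrite -mulnBl in h6; rewrite {2}mulSn addKn in h3.
rewrite /clausen_a -h6 -[in X in _ = (_ * (X * _))%N]h3; ring.
Qed.

Lemma clausen_a_rec k :
  (k.+1 ^ 2 * clausen_a k.+1 = 12 * (6 * k + 1) * (6 * k + 5) * clausen_a k)%N.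
Proof.
have hS := clausen_a_fact k.+1; have h := clausen_a_fact k.
have e2 : (2 * k.+1 = (2 * k).+2)%N by ring.
have e3 : (3 * k.+1 = (3 * k).+3)%N by ring.
have e6 : (6 * k.+1 = (3 + (3 + 6 * k)))%N by ring.
rewrite e2 e3 e6 !factS /= -h in hS.
apply/eqP; rewrite -(eqn_pmul2r (_ : 0 < 6 * k.+1 * (2 * k + 1) * (3 * k + 1)
  * (3 * k + 2) * (k`! * (2 * k)`! * (3 * k)`!))%N); last first.
  by rewrite !muln_gt0 !fact_gt0 !addn_gt0 !orbT.
apply/eqP.
transitivity (clausen_a k.+1 *
       (k.+1 * k`! * ((2 * k).+2 * ((2 * k).+1 * (2 * k)`!)) *
        ((3 * k).+3 * ((3 * k).+2 * ((3 * k).+1 * (3 * k)`!)))))%N; first ring.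
rewrite hS; ring.
Qed.

Lemma central_bin_rec k :
  (k.+1 * 'C(2 * k.+1, k.+1) = 2 * (2 * k + 1) * 'C(2 * k, k))%N.
Proof.
have h := @bin_fact (2 * k) k (leq_pmull k (isT : (0 < 2)%N)).
have hS := @bin_fact (2 * k.+1) k.+1 (leq_pmull k.+1 (isT : (0 < 2)%N)).
rewrite {2}mulSn addKn mul1n in h; rewrite {2}mulSn addKn mul1n in hS.
have e2 : (2 * k.+1 = (2 * k).+2)%N by ring.
rewrite {2}e2 !factS -h in hS.
apply/eqP; rewrite -(eqn_pmul2r (_ : 0 < k.+1 * (k`! * k`!))%N); last first.
  by rewrite !muln_gt0 !fact_gt0.
apply/eqP.
transitivity ('C(2 * k.+1, k.+1) * (k.+1 * k`! * (k.+1 * k`!)))%N; first ring.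
rewrite hS; ring.
Qed.

Lemma clausen_b_rec k :
  (k.+1 ^ 3 * clausen_b k.+1
   = 24 * (2 * k + 1) * (6 * k + 1) * (6 * k + 5) * clausen_b k)%N.
Proof.
transitivity ((k.+1 * 'C(2 * k.+1, k.+1)) * (k.+1 ^ 2 * clausen_a k.+1))%N.
  rewrite /clausen_b; ring.
rewrite central_bin_rec clausen_a_rec /clausen_b; ring.
Qed.

(** By Vandermonde C(2p,p) = sum_k C(p,k)^2, and p divides C(p,k) except for
    the two extreme terms. *)
Lemma central_bin_prime_mod p : prime p -> ('C(2 * p, p) = 2 %[mod p ^ 2])%N.
Proof.
case: p => // p p_pr.
rewrite mul2n -addnn -binomial.Vandermonde big_ord_recr big_ord_recl /=.
rewrite subn0 subnn bin0 binn.
rewrite (_ : 1 * 1 + _ + 1 * 1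
  = \sum_(i < p) 'C(p.+1, i.+1) * 'C(p.+1, p.+1 - i.+1) + 2)%N; last by ring.
apply/eqP; rewrite -[X in _ == X %[mod _]]add0n eqn_modDr mod0n.
apply: dvdn_sum => i _.
by rewrite (@bin_sub p.+1 i.+1) ?ltnS 1?ltnW // -mulnn dvdn_mul // prime_dvd_bin //= ltnS.
Qed.

(** * Integer polynomials: Euler derivation and truncated series *)

Lemma deriv1 : (1 : {poly int})^`() = 0.
Proof. by rewrite -polyC1 derivC. Qed.

Lemma deriv_natrM n (q : {poly int}) : (n%:R * q)^`() = n%:R * q^`().
Proof. by rewrite mulr_natl derivMn mulr_natl. Qed.

Lemma comp_poly_natrM n (q r : {poly int}) :
  (n%:R * q) \Po r = n%:R * (q \Po r).
Proof. by rewrite comp_polyM -polyC_natr comp_polyC. Qed.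

Lemma comp_polyXn n (r : {poly int}) : 'X^n \Po r = r ^+ n.
Proof.
elim: n => [|n IH]; first by rewrite !expr0 -polyC1 comp_polyC.
by rewrite !exprS comp_polyM comp_polyX IH.
Qed.

(** On a monomial 'X^n the derivation x d/dx is multiplication by n, so the
    hypergeometric operators are polynomials in it and act on truncated series
    through the recurrence of the coefficients. *)
Definition euler (p : {poly int}) := 'X * p^`().

Lemma eulerXn n : euler 'X^n = n%:R * 'X^n.
Proof.
rewrite /euler derivXn; case: n => [|n]; first by rewrite mulr0n mulr0 mul0r.
by rewrite /= mulrnAr -exprS mulr_natl.
Qed.

Lemma eulerD p q : euler (p + q) = euler p + euler q.
Proof. by rewrite /euler derivD mulrDr. Qed.

Lemma eulerZ (n : nat) p : euler (n%:R * p) = n%:R * euler p.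
Proof. by rewrite /euler deriv_natrM; ring. Qed.

Lemma euler0 : euler 0 = 0.
Proof. by rewrite /euler deriv0 mulr0. Qed.

Lemma coef_euler p i : (euler p)`_i = i%:R * p`_i.
Proof.
by rewrite /euler coefXM coef_deriv; case: i => [|i]; rewrite ?mul0r // mulr_natl.
Qed.

Definition trunc (c : nat -> nat) (n : nat) : {poly int} :=
  \sum_(0 <= k < n) (c k)%:R * 'X^k.

Lemma truncS c n : trunc c n.+1 = trunc c n + (c n)%:R * 'X^n.
Proof. by rewrite /trunc big_nat_recr. Qed.

Lemma trunc0 c : trunc c 0 = 0.
Proof. by rewrite /trunc big_geq. Qed.

Lemma coef0_truncS c n : (trunc c n.+1)`_0 = (c 0%N)%:R.
Proof.
rewrite /trunc big_nat_recl // coefD expr0 mulr1 -polyC_natr coefC /=.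
rewrite coef_sum big1 ?addr0 // => i _.
by rewrite coefMXn.
Qed.

Lemma size_trunc c n : (size (trunc c n) <= n)%N.
Proof.
elim: n => [|n IHn]; first by rewrite trunc0 size_poly0.
rewrite truncS (leq_trans (size_polyD _ _)) // geq_max (leqW IHn) /=.
by rewrite -polyC_natr mul_polyC (leq_trans (size_scale_leq _ _)) // size_polyXn.
Qed.

(** * The second-order equation of the truncated hypergeometric series *)

Definition quad : {poly int} := 'X * (1 - 432%:R * 'X).
Definition quad' : {poly int} := 1 - 864%:R * 'X.

Lemma deriv_quad : quad^`() = quad'.
Proof.
rewrite /quad /quad' ?derivM derivB deriv1 deriv_natrM derivX; ring.
Qed.

Lemma deriv_quad' : quad'^`() = - 864%:R.
Proof.
rewrite /quad /quad' ?derivM derivB deriv1 deriv_natrM derivX; ring.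
Qed.

(** The operator (w y')' - 60 y with w = [quad]: in the variable 432x it is the
    Gauss operator with parameters 1/6, 5/6; 1. *)
Definition hyper2 (y : {poly int}) : {poly int} :=
  quad * y^`()^`() + quad' * y^`() - 60%:R * y.

(** With theta = x d/dx, this is theta^2 - 12 x (6 theta + 1)(6 theta + 5),
    which mirrors [clausen_a_rec]. *)
Lemma hyper2_euler y :
  'X * hyper2 y = euler (euler y)
  - 12%:R * 'X * (36%:R * euler (euler y) + 36%:R * euler y + 5%:R * y).
Proof.
rewrite /euler derivM derivX /hyper2 /quad /quad'; ring.
Qed.

(** The contributions of consecutive monomials telescope by [clausen_a_rec];
    only the one at the truncation point survives. *)
Lemma hyper2_trunc n :
  hyper2 (trunc clausen_a n.+1) = - (n.+1 ^ 2 * clausen_a n.+1)%N%:R * 'X^n.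
Proof.
apply: (mulfI (negbT (polyX_eq0 _))); rewrite hyper2_euler [RHS]mulrCA -exprS.
elim: n.+1 => [|k IHk]; first by rewrite trunc0 !euler0; ring.
rewrite truncS !(eulerD, eulerZ, eulerXn) clausen_a_rec.
move/eqP: IHk; move: (clausen_a k) => c; rewrite -subr_eq0 => /eqP IHk.
apply/eqP; rewrite -subr_eq0 -[X in _ == X]IHk.
apply/eqP; rewrite exprS !(natrM, natrD); ring.
Qed.

(** * The third-order equation of the truncated product series *)

(** The 3F2 operator with parameters 1/6, 1/2, 5/6; 1, 1 in the variable 1728u,
    with one factor u removed so that it is expressed by ordinary derivatives;
    see [hyper3_euler] for the usual form. *)
Definition hyper3 (P : {poly int}) : {poly int} :=
  'X ^+ 2 * P^`()^`()^`() + 3%:R * ('X * P^`()^`()) + P^`()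
  - 24%:R * (72%:R * ('X ^+ 3 * P^`()^`()^`()) + 324%:R * ('X ^+ 2 * P^`()^`())
             + 226%:R * ('X * P^`()) + 5%:R * P).

(** With theta = u d/du, this is
    theta^3 - 24 u (2 theta + 1)(6 theta + 1)(6 theta + 5). *)
Lemma hyper3_euler P :
  'X * hyper3 P = euler (euler (euler P))
  - 24%:R * 'X * (72%:R * euler (euler (euler P)) + 108%:R * euler (euler P)
                  + 46%:R * euler P + 5%:R * P).
Proof.
rewrite /euler !(derivM, derivD, derivX, deriv1) /hyper3.
move: (P^`()^`()^`()) (P^`()^`()) (P^`()) => p3 p2 p1.
ring.
Qed.

Lemma hyper3_trunc n :
  hyper3 (trunc clausen_b n.+1) = - (n.+1 ^ 3 * clausen_b n.+1)%N%:R * 'X^n.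
Proof.
apply: (mulfI (negbT (polyX_eq0 _))); rewrite hyper3_euler [RHS]mulrCA -exprS.
elim: n.+1 => [|k IHk]; first by rewrite trunc0 !euler0; ring.
rewrite truncS !(eulerD, eulerZ, eulerXn) clausen_b_rec.
move/eqP: IHk; move: (clausen_b k) => c; rewrite -subr_eq0 => /eqP IHk.
apply/eqP; rewrite -subr_eq0 -[X in _ == X]IHk.
apply/eqP; rewrite exprS !(natrM, natrD); ring.
Qed.

(** * The symmetric square of the second-order equation *)

(** The symmetric square of y'' + p y' + q y, namely
    s''' + 3p s'' + (2p^2 + p' + 4q) s' + (4pq + 2q') s, for p = w'/w and
    q = -60/w, multiplied by w^2 to clear denominators; w'' = -864 is used. *)
Definition symsq (s : {poly int}) : {poly int} :=
  quad ^+ 2 * s^`()^`()^`() + 3%:R * quad * quad' * s^`()^`()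
  + (quad' ^+ 2 - 1104%:R * quad) * s^`() - 120%:R * quad' * s.

(** The inhomogeneous form of the fact that squares of solutions of the
    second-order equation solve the symmetric square. *)
Lemma symsq_sqr (y : {poly int}) :
  symsq (y ^+ 2) = 2%:R * quad * y * (hyper2 y)^`()
     + (6%:R * quad * y^`() + 2%:R * quad' * y) * hyper2 y.
Proof.
rewrite /symsq /hyper2 expr2.
rewrite !(deriv_quad, deriv_quad', deriv_natrM, derivD, derivN, derivM).
move: (y^`()^`()^`()) (y^`()^`()) (y^`()) => y3 y2 y1.
ring.
Qed.

(** This is the analytic content of Clausen's formula.  It rests on the relation
    w'^2 = 1 - 1728 w, which turns the coefficients of the pulled-back operator
    into polynomials in w. *)
Lemma symsq_comp (P : {poly int}) :
  symsq (P \Po quad) = (hyper3 P \Po quad) * quad'.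
Proof.
have e1 (Q : {poly int}) : (Q \Po quad)^`() = (Q^`() \Po quad) * quad'.
  by rewrite deriv_comp deriv_quad.
have e2 : (P \Po quad)^`()^`() = (P^`()^`() \Po quad) * quad' ^+ 2
                               - 864%:R * (P^`() \Po quad).
  by rewrite e1 derivM e1 deriv_quad'; ring.
have e3 : (P \Po quad)^`()^`()^`() = (P^`()^`()^`() \Po quad) * quad' ^+ 3
                               - 2592%:R * quad' * (P^`()^`() \Po quad).
  by rewrite e2 derivB deriv_natrM derivM !e1 expr2 derivM deriv_quad'; ring.
rewrite /symsq e3 e2 e1 /hyper3.
rewrite comp_polyB !comp_polyD !comp_poly_natrM !comp_polyD !comp_poly_natrM.
rewrite ?comp_polyXn !comp_polyM ?comp_polyXn !comp_polyX.
move: (P^`()^`()^`() \Po quad) (P^`()^`() \Po quad) (P^`() \Po quad) (P \Po quad) => p3 p2 p1 p.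
rewrite /quad /quad'.
ring.
Qed.

Lemma symsqB s t : symsq (s - t) = symsq s - symsq t.
Proof. by rewrite /symsq !derivB; ring. Qed.

(** * The coefficient recurrence of the symmetric square *)

Definition dvd_upto (m : int) (n : nat) (p : {poly int}) : Prop :=
  forall i, (i <= n)%N -> (m %| p`_i)%Z.

Lemma dvd_uptoD m n p q : dvd_upto m n p -> dvd_upto m n q -> dvd_upto m n (p + q).
Proof.
move=> hp hq i hi.
by rewrite coefD; apply: rpredD; [apply: hp | apply: hq].
Qed.

Lemma dvd_uptoM m n p q : dvd_upto m n q -> dvd_upto m n (p * q).
Proof.
move=> hq i hi; rewrite coefM; apply: rpred_sum => j _.
by rewrite dvdz_mull // hq // (leq_trans (leq_subr _ _)).
Qed.

Lemma dvd_upto_euler m n p : dvd_upto m n p -> dvd_upto m n (euler p).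
Proof. by move=> hp i hi; rewrite coef_euler dvdz_mull ?hp. Qed.

(** The lowest-order part of the operator is theta^3 / x, whatever the rest is;
    this separates it from terms that carry an extra factor x. *)
Lemma symsq_euler s :
  'X * symsq s = euler (euler (euler s))
    + 'X * ((- 864%:R + 432%:R ^+ 2 * 'X) * euler (euler (euler s))
            + (- 1296%:R + 3%:R * 432%:R ^+ 2 * 'X) * euler (euler s)
            + (- 672%:R + 1104%:R * 432%:R * 'X) * euler s
            + (- 120%:R * quad') * s).
Proof.
rewrite /euler !(derivM, derivD, derivX, deriv1) /symsq /quad /quad'.
move: (s^`()^`()^`()) (s^`()^`()) (s^`()) => s1 s2 s3.
ring.
Qed.

(** The modulus m is arbitrary: m = 0 gives the exact vanishing of coefficients,
    and m = p^2 the congruence. *)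
Lemma symsq_coef_rec m n s : dvd_upto m n s -> (m %| (symsq s)`_n)%Z ->
  (m %| (n.+1 ^ 3)%N%:R * s`_n.+1)%Z.
Proof.
move=> hs; move: (symsq s) (symsq_euler s) => t; set r := (X in _ + 'X * X) => ht hdvd.
have hr : dvd_upto m n r.
  by do 3?apply: dvd_uptoD; apply: dvd_uptoM; do ?apply: dvd_upto_euler.
have -> : (n.+1 ^ 3)%N%:R * s`_n.+1 = t`_n - r`_n.
  have <- : ('X * t)`_n.+1 = t`_n by rewrite coefXM.
  rewrite ht coefD !coef_euler coefXM /= natrX; ring.
by apply: rpredB => //; apply: hr.
Qed.

(** * The defect of the truncated Clausen identity *)

Definition defect (n : nat) : {poly int} :=
  (trunc clausen_b n \Po quad) - trunc clausen_a n ^+ 2.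

(** Each side contributes its boundary term.  On the side of the square one
    summand contains the derivative of 'X^n, and the factor x of w restores the
    lost power. *)
Lemma symsq_defect n :
  exists h, symsq (defect n.+1) = (n.+1 ^ 2)%N%:R * 'X^n * h.
Proof.
rewrite /defect symsqB symsq_comp hyper3_trunc symsq_sqr hyper2_trunc.
rewrite mulNr -mulrN comp_poly_natrM.
set c := clausen_a n.+1; set d := clausen_b n.+1; set y := trunc _ _.
have -> : (- 'X^n \Po quad) = - ('X^n * (1 - 432%:R * 'X) ^+ n).
  by rewrite -mulN1r comp_polyM comp_polyXn exprMn -polyC1 -polyCN comp_polyC polyCN polyC1 mulN1r.
have -> : (- (n.+1 ^ 2 * c)%N%:R * 'X^n : {poly int})^`() = - (n.+1 ^ 2 * c)%N%:R * 'X^n^`().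
  by rewrite mulNr derivN deriv_natrM mulNr.
have := eulerXn n; rewrite /euler => hX.
exists (- (n.+1 * d)%N%:R * (1 - 432%:R * 'X) ^+ n * quad'
  + c%:R * (2%:R * (1 - 432%:R * 'X) * y * n%:R + 6%:R * quad * y^`() + 2%:R * quad' * y)).
(* One factor x is moved from w to the derivative, to form the Euler derivation. *)
have -> : 2 * quad * y * (- (n.+1 ^ 2 * c)%N%:R * 'X^n^`())
  = 2 * (1 - 432%:R * 'X) * y * (- (n.+1 ^ 2 * c)%N%:R) * ('X * 'X^n^`()).
  rewrite /quad; move: ('X^n^`()) => z; ring.
rewrite hX; move: quad quad' (y^`()) ((1 - 432%:R * 'X) ^+ n) => w w' y' v.
by rewrite expnS; ring.
Qed.

Lemma dvd_upto0_eq n p : dvd_upto 0 n p -> forall i, (i <= n)%N -> p`_i = 0.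
Proof. by move=> hp i /hp; rewrite dvd0z => /eqP. Qed.

(** Clausen's formula itself: below the truncation point the defect is 0. *)
Lemma coef_defect_lt n i : (i < n)%N -> (defect n)`_i = 0.
Proof.
case: n => // n; rewrite ltnS.
suff h j : (j <= n)%N -> dvd_upto 0 j (defect n.+1).
  by move=> hi; exact: dvd_upto0_eq (h i hi) _ (leqnn i).
elim: j => [_ k|j IHj hj k].
  rewrite leqn0 => /eqP ->; rewrite dvd0z.
  rewrite /defect -horner_coef0 !hornerE horner_comp /quad !hornerE.
  rewrite !horner_coef0 !coef0_truncS.
  (* Both constant coefficients are 1. *)
  by [].
rewrite leq_eqVlt ltnS => /orP [/eqP -> | hk]; last exact: IHj (ltnW hj) k hk.
have [h hh] := symsq_defect n.
have := symsq_coef_rec (IHj (ltnW hj)).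
rewrite hh -mulrA mulrCA coefXnM hj dvdz0 => /(_ isT).
rewrite !dvd0z mulf_eq0 => /orP [|//].
by rewrite pnatr_eq0.
Qed.

(** Modulo p^2 the recurrence carries no information here when n.+1 = p, as its
    leading factor is p^3.  The value is instead the difference between this defect and
    the next one, whose coefficient vanishes by [coef_defect_lt]; both differ
    only through the monomials b_N w^N and a_N x^N, with N = n.+1. *)
Lemma coef_defect_eq n : (defect n.+1)`_n.+1
  = - (('C(2 * n.+1, n.+1)%:R - 2%:R) * (clausen_a n.+1)%:R).
Proof.
have := coef_defect_lt (ltnSn n.+1); move: (ltn0Sn n).
rewrite /defect !(truncS _ n.+1); move En : n.+1 => N N_gt0.
rewrite sqrrD comp_polyD comp_poly_natrM comp_polyXn /quad exprMn.
set y := trunc clausen_a N; set z := trunc clausen_b N \Po _.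
set c := clausen_a N; set v := 1 - 432%:R * 'X.
have -> : z + (clausen_b N)%:R * ('X^N * v ^+ N)
    - (y ^+ 2 + y * (c%:R * 'X^N) *+ 2 + (c%:R * 'X^N) ^+ 2)
  = z - y ^+ 2 + 'X^N * ((clausen_b N)%:R * v ^+ N - c%:R * (2%:R * y + c%:R * 'X^N)).
  by ring.
move: (z - y ^+ 2) => d.
rewrite coefD coefXnM ltnn subnn => /eqP; rewrite addr_eq0 => /eqP ->; congr (- _).
have v0 : v.[0] = 1 by rewrite /v hornerD hornerN hornerC hornerM hornerX mulr0 subr0.
have nat0 k : (k%:R : {poly int}).[0] = k%:R by rewrite -polyC_natr hornerC.
have y0 : y.[0] = 1 by rewrite horner_coef0 /y -En coef0_truncS.
rewrite -horner_coef0 hornerD hornerN !hornerM hornerD !hornerM !nat0 horner_exp v0 y0.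
rewrite hornerXn expr1n expr0n gtn_eqF //=.
by rewrite /clausen_b -/c natrM; ring.
Qed.

Lemma size_defect n : (size (defect n.+1) <= 2 * n + 1)%N.
Proof.
have hT c : ((size (trunc c n.+1)).-1 <= n)%N.
  by case: (size _) (size_trunc c n.+1).
rewrite /defect (leq_trans (size_polyD _ _)) // geq_max size_polyN; apply/andP; split.
  have hq : (size quad <= 3)%N.
    rewrite /quad mulrC (leq_trans (size_polyMleq _ _)) // size_polyX addn2 /= ltnS.
    rewrite (leq_trans (size_polyD _ _)) // geq_max size_poly1 size_polyN /=.
    by rewrite -polyC_natr mul_polyC (leq_trans (size_scale_leq _ _)) // size_polyX.
  rewrite (leq_trans (size_comp_poly_leq _ _)) // addn1 ltnS mulnC leq_mul //.
  by case: (size quad) hq.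
rewrite (leq_trans (size_poly_exp_leq _ _)) // addn1 ltnS mulnC leq_mul //.
Qed.

Lemma defect_prime p i : prime p -> ((p ^ 2)%N%:Z %| (defect p)`_i)%Z.
Proof.
case: p => // n p_pr; have [hi|hi] := leqP n.+1 i; last first.
  by rewrite coef_defect_lt // dvdz0.
have [hi2|hi2] := leqP (2 * n + 1) i.
  by rewrite nth_default ?dvdz0 // (leq_trans (size_defect n)).
suff h j : (j <= n)%N -> dvd_upto (n.+1 ^ 2)%N%:Z (n.+1 + j) (defect n.+1).
  apply: (h (i - n.+1)%N); rewrite ?subnKC // leq_subLR; lia.
(* Starting at p = n.+1 steps over the one index where the leading factor of
   the recurrence is not invertible. *)
elim: j => [_ k|j IHj hj k].
  rewrite addn0 leq_eqVlt => /orP [/eqP -> | hk]; last by rewrite coef_defect_lt // dvdz0.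
  rewrite coef_defect_eq; apply: rpredNr; apply: dvdz_mulr.
  by rewrite !natz -eqz_mod_dvd !modz_nat central_bin_prime_mod.
rewrite addnS leq_eqVlt ltnS => /orP [/eqP -> | hk]; last exact: IHj (ltnW hj) k hk.
have [h hh] := symsq_defect n.
have := symsq_coef_rec (IHj (ltnW hj)); rewrite hh -mulrA.
rewrite -polyC_natr coefCM natz dvdz_mulr // => /(_ isT).
rewrite natz Gauss_dvdzr // coprimezE !absz_nat.
rewrite coprimeXl // coprimeXr // prime_coprime //.
by rewrite -addnS dvdn_addr ?dvdnn // gtnNdvd.
Qed.

Theorem theorem3p1 (p : nat) (p_prime : prime p) (p_odd : odd p) :
  eqpoly_mod (p ^ 2)%N%:Z
    (\sum_(0 <= k < p)
       ('C(2 * k, k) * 'C(3 * k, k) * 'C(6 * k, 3 * k))%N%:R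
         * ('X * (1 - 432%:R * 'X)) ^+ k)
    ((\sum_(0 <= k < p) ('C(3 * k, k) * 'C(6 * k, 3 * k))%N%:R * 'X^k) ^+ 2).
Proof.
move=> i; apply/eqP; rewrite eqz_mod_dvd -coefB.
have -> : \sum_(0 <= k < p) ('C(2 * k, k) * 'C(3 * k, k) * 'C(6 * k, 3 * k))%N%:R
         * ('X * (1 - 432%:R * 'X)) ^+ k = trunc clausen_b p \Po quad.
  rewrite /trunc (raddf_sum (comp_poly quad)) /=; apply: eq_bigr => k _.
  by rewrite comp_poly_natrM comp_polyXn /clausen_b mulnA.
exact: defect_prime.
Qed.
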